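(* Let $X=\{X_i\}_{i=1}^n$ be Boolean variables, let $\mathcal{C}=\{c_j\}_{j=1}^L$ be a set of constraints on $\mathcal{X}=\{0,1\}^n$ that is extremal and has at least one satisfying assignment, and let $\theta=(\theta_1,\dots,\theta_n)\in\mathbb{R}^n$ be the parameters of the constrained Markov random field in single-variable form. Then, upon termination, the sampling algorithm described in the context outputs an assignment $x$ that is distributed according to the constrained Markov random field, i.e. conditionally on termination, for every $x\in\mathcal{X}$ the probability that the output equals $x$ is $$P_\theta(X=x\mid\mathcal{C})=\frac{\exp\left(\sum_{i=1}^n\theta_i x_i\right)C(x)}{\sum_{x'\in\mathcal{X}}\exp\left(\sum_{i=1}^n\theta_i x'_i\right)C(x')} .$$
   Context: Constraints: each constraint $c_j$ is a function $c_j:\mathcal{X}=\{0,1\}^n\to\{0,1\}$ whose value depends only on the variables in a subset $\mathrm{var}(c_j)\subseteq\{X_1,\dots,X_n\}$; $c_j(x)=1$ means $x$ satisfies $c_j$, and $c_j(x)=0$ means $x$ violates $c_j$. Put $C(x)=\prod_{j=1}^L c_j(x)$, so $C(x)=1$ iff all constraints are satisfied. Extremal: $\mathcal{C}$ is called extremal if for each pair of (distinct) constraints $c_i,c_j\in\mathcal{C}$, either $\mathrm{var}(c_i)\cap\mathrm{var}(c_j)=\emptyset$, or for all $x\in\mathcal{X}$ one has $c_i(x)=1$ or $c_j(x)=1$. Sampling algorithm (with input $X,\mathcal{C},\theta$): (1) Initially draw $x_1,\dots,x_n$ independently, where $x_i\in\{0,1\}$ is chosen with probability $\exp(\theta_i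 x_i)/(1+\exp(\theta_i))$. (2) While $C(x)=0$: find the set $S=\{c_j\in\mathcal{C}: c_j(x)=0\}$ of all violated constraints, and redraw, independently of everything before and of each other, every $x_k$ with $X_k\in\mathrm{var}(S)=\bigcup_{c_j\in S}\mathrm{var}(c_j)$ from the same marginal distribution $\exp(\theta_k x_k)/(1+\exp(\theta_k))$, leaving all other coordinates unchanged. (3) When $C(x)=1$, stop and output $x$. *)

(* Defs.v *)
From HB Require Import structures.
From mathcomp Require Import all_boot all_order all_algebra.
From mathcomp Require Import all_classical all_reals all_analysis.
Set Implicit Arguments.
Unset Strict Implicit.
Unset Printing Implicit Defensive.
Import Order.TTheory GRing.Theory Num.Theory.
Local Open Scope classical_set_scope.
Local Open Scope ring_scope.

Definition assignment (n : nat) : finType := {ffun 'I_n -> bool}.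

(* [cvar] is part of the data: any set of variables that determines the value
   of the constraint, not necessarily the smallest one. *)
Record constraint (n : nat) := Constraint {
  cfun :> assignment n -> bool;
  cvar : {set 'I_n};
  cfun_local : forall x y : assignment n,
    (forall k, k \in cvar -> x k = y k) -> cfun x = cfun y }.

Definition satisfies (n L : nat) (C : 'I_L -> constraint n)
  (x : assignment n) : bool := [forall j, C j x].

Definition extremal (n L : nat) (C : 'I_L -> constraint n) : Prop :=
  forall i j : 'I_L, i != j ->
    (cvar (C i) :&: cvar (C j))%SET = finset.set0 \/
    (forall x : assignment n, C i x \/ C j x).

Definition violated (n L : nat) (C : 'I_L -> constraint n)
  (x : assignment n) : {set 'I_L} := [set j | ~~ C j x]%SET.

Definition violated_vars (n L : nat) (C : 'I_L -> constraint n)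
  (x : assignment n) : {set 'I_n} :=
  (\bigcup_(j in violated C x) cvar (C j))%SET.

(* The coin [z t k] is the value available for variable [k] at round [t]; it is
   read at round 0 and at each round that redraws [k], so every redraw uses a
   coin that has not been read before.  Once the assignment satisfies all the
   constraints, nothing is redrawn and the state is constant. *)
Fixpoint state (n L : nat) (C : 'I_L -> constraint n) (z : nat -> 'I_n -> bool)
  (t : nat) : assignment n :=
  if t is s.+1 then
    let x := state C z s in
    [ffun k => if k \in violated_vars C x then z t k else x k]
  else [ffun k => z 0%N k].

Definition stops_at (n L : nat) (C : 'I_L -> constraint n)
  (z : nat -> 'I_n -> bool) (t : nat) : Prop :=
  satisfies C (state C z t) /\
  (forall s, (s < t)%N -> ~~ satisfies C (state C z s)).

Definition terminates (n L : nat) (C : 'I_L -> constraint n)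
  (z : nat -> 'I_n -> bool) : Prop := exists t, stops_at C z t.

Definition outputs (n L : nat) (C : 'I_L -> constraint n)
  (z : nat -> 'I_n -> bool) (x : assignment n) : Prop :=
  exists t, stops_at C z t /\ state C z t = x.

Definition mutually_independent (R : realType) (d d' : measure_display)
  (T : measurableType d) (T' : measurableType d') (P : probability T R)
  (I : eqType) (X : I -> {RV P >-> T'}) : Prop :=
  forall (J : seq I) (B : I -> set T'), uniq J ->
    (forall i, measurable (B i)) ->
    P (\bigcap_(i in [set` J]) (X i @^-1` B i)) =
    (\prod_(i <- J) P (X i @^-1` B i))%E.

Definition marginal (R : realType) (a : R) (b : bool) : R :=
  expR (a * b%:R) / (1 + expR a).

Definition are_coins (R : realType) (n : nat) (theta : 'I_n -> R)
  (d : measure_display) (T : measurableType d) (P : probability T R)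
  (Z : nat -> 'I_n -> {RV P >-> bool}) : Prop :=
  (forall t k b, P (Z t k @^-1` [set b]) = (marginal (theta k) b)%:E) /\
  mutually_independent (fun i : nat * 'I_n => Z i.1 i.2).

(* When [P B = 0] this is 0 for every [A]. *)
Definition cond_prob (R : realType) (d : measure_display)
  (T : measurableType d) (P : probability T R) (A B : set T) : R :=
  fine (P (A `&` B)) / fine (P B).

Definition mrf_weight (R : realType) (n : nat) (theta : 'I_n -> R)
  (x : assignment n) : R := expR (\sum_(i < n) theta i * (x i)%:R).

Definition constrained_mrf (R : realType) (n L : nat) (theta : 'I_n -> R)
  (C : 'I_L -> constraint n) (x : assignment n) : R :=
  mrf_weight theta x * (satisfies C x)%:R /
  \sum_(y : assignment n) mrf_weight theta y * (satisfies C y)%:R.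

(* Main.v *)
Require Import Defs.
From HB Require Import structures.
From mathcomp Require Import all_boot all_order all_algebra.
From mathcomp Require Import all_classical all_reals all_analysis.
From mathcomp Require Import ring.
Set Implicit Arguments.
Unset Strict Implicit.
Unset Printing Implicit Defensive.
Import Order.TTheory GRing.Theory Num.Theory numFieldNormedType.Exports.
Local Open Scope classical_set_scope.
Local Open Scope ring_scope.

(* The state is a Markov chain whose law [q t] satisfies, for the product law
   [mu] of the coins, [q t x * mu x' = q t x' * mu x] whenever [x] and [x']
   violate the same constraints. For the induction step fix the set [S] of
   constraints violated at round [t] and let [V] be their variables: replacing
   the values of [x] outside [V] by those of [x'] is a bijection between the
   predecessors of [x] and [x'] that violate exactly [S], because of
   extremality. In particular [q t] is proportional to [mu] on the satisfying
   assignments. These are absorbing, so the probability of the output [x] is the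
   limit of [q t x], and the proportionality passes to the limit. *)

(** * Balance between assignments that violate the same constraints *)

Section BalanceOfStates.
Variables (R : realType) (n L : nat) (C : 'I_L -> constraint n).
Variable theta : 'I_n -> R.
Implicit Types (x y : assignment n) (V : {set 'I_n}).

Definition splice V y x : assignment n :=
  [ffun k => if k \in V then y k else x k].

(** Splicing with [x'] and then with [x] loses nothing, since [y] already agrees with [x] off [V];
    this is the inverse law of the bijection between predecessors. *)
Lemma splice_splice V y x x' :
  (forall k, k \notin V -> y k = x k) -> splice V (splice V y x') x = y.
Proof.
move=> yx; apply/ffunP => k; rewrite !ffunE.
by case: (boolP (k \in V)) => // /yx.
Qed.

Lemma violatedP x j : (j \in violated C x) = ~~ C j x.
Proof. by rewrite inE. Qed.

(* A constraint outside [violated C y] that meets the redrawn variables shares a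
   variable with a violated constraint, which by extremality rules out that it
   is violated itself; a constraint that does not meet them only sees [x']. *)
Lemma violated_splice x x' y : extremal C ->
  violated C x = violated C x' ->
  (forall k, k \notin violated_vars C y -> y k = x k) ->
  violated C (splice (violated_vars C y) y x') = violated C y.
Proof.
move=> Cext xx' yx; set V := violated_vars C y; set y' := splice V y x'.
have Cy'S i : i \in violated C y -> C i y' = C i y.
  move=> iS; apply: cfun_local => k ki; rewrite ffunE.
  by rewrite ifT//; apply/bigcupP; exists i.
apply/setP => j; rewrite !violatedP; congr (~~ _).
have [jS|jS] := boolP (j \in violated C y); first exact: Cy'S.
have [jV|] := boolP [disjoint cvar (C j) & V].
  have notV k : k \in cvar (C j) -> k \notin V by move/(disjointFr jV) => ->.
  have -> : C j y' = C j x'.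
    by apply: cfun_local => k /notV kV; rewrite ffunE (negbTE kV).
  have -> : C j y = C j x by apply: cfun_local => k /notV /yx.
  by apply: negb_inj; rewrite -!violatedP xx'.
case/pred0Pn => k /= /andP[kj /bigcupP[i iS ki]].
have ij : i != j by apply: contraNneq jS => <-.
move: (jS); rewrite violatedP negbK => ->.
have [/setP/(_ k)|/(_ y')] := Cext i j ij; first by rewrite !inE ki kj.
by rewrite Cy'S//; move: iS; rewrite violatedP => /negbTE -> [].
Qed.

Definition coins_prob (V : {pred 'I_n}) x : R :=
  \prod_(k in V) marginal (theta k) (x k).

(** One-step transition kernel from [y] to [x]. At a satisfying [y] nothing is redrawn and the empty
    product makes it the identity. *)
Definition redraw_prob y x : R :=
  if [forall k, (k \notin violated_vars C y) ==> (y k == x k)]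
  then coins_prob (mem (violated_vars C y)) x else 0.

Fixpoint state_prob t x : R :=
  if t is s.+1 then \sum_y state_prob s y * redraw_prob y x
  else coins_prob predT x.

Lemma marginal_gt0 (a : R) b : 0 < marginal a b.
Proof. by rewrite divr_gt0 ?expR_gt0// addr_gt0 ?expR_gt0. Qed.

Lemma coins_prob_gt0 (V : {pred 'I_n}) x : 0 < coins_prob V x.
Proof. by apply: prodr_gt0 => k _; exact: marginal_gt0. Qed.

Lemma coins_probID V x :
  coins_prob predT x = coins_prob (mem V) x * coins_prob (mem (~: V)%SET) x.
Proof.
rewrite /coins_prob (bigID (mem V))/=; congr (_ * _).
by apply: eq_bigl => k; rewrite inE.
Qed.

Lemma eq_coins_prob (V : {pred 'I_n}) x y :
  (forall k, k \in V -> x k = y k) -> coins_prob V x = coins_prob V y.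
Proof. by move=> xy; apply: eq_bigr => k /xy ->. Qed.

Lemma state_prob_balanced t x x' : extremal C ->
  violated C x = violated C x' ->
  state_prob t x * coins_prob predT x' = state_prob t x' * coins_prob predT x.
Proof.
move=> Cext; elim: t x x' => [|t IH] x x' xx' /=; first exact: mulrC.
have agreeP V y z : reflect (forall k, k \notin V -> y k = z k)
    [forall k, (k \notin V) ==> (y k == z k)].
  apply: (iffP forallP) => yz k; last by apply/implyP => /yz ->.
  by move=> kV; apply/eqP; exact: (implyP (yz k)).
rewrite !mulr_suml.
rewrite (partition_big (violated C) predT)//=.
rewrite [RHS](partition_big (violated C) predT)//=.
apply: eq_bigr => S _.
set V := (\bigcup_(j in S) cvar (C j))%SET.
pose agree y z := [forall k, (k \notin V) ==> (y k == z k)].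
(* The kernel vanishes unless [y] agrees with [z] off [V], so only genuine predecessors of [z]
   remain in the sum. *)
have restrict z c : \sum_(y | violated C y == S)
      state_prob t y * redraw_prob y z * c =
    \sum_(y | (violated C y == S) && agree y z)
      state_prob t y * coins_prob (mem V) z * c.
  rewrite big_mkcondr/=; apply: eq_bigr => y /eqP yS.
  rewrite /redraw_prob /violated_vars yS -/V -/(agree y z).
  by case: ifP => // _; rewrite mulr0 mul0r.
rewrite !restrict.
(* From here on [y] stands for a predecessor of [x'], and [splice V y x] is the matching predecessor
   of [x]. *)
rewrite (reindex_onto (fun y => splice V y x) (fun y => splice V y x'));
  last by move=> y /andP[_ /agreeP]; exact: splice_splice.
have splice_agree y z : agree (splice V y z) z.
  by apply/agreeP => k /negbTE kV; rewrite ffunE kV.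
have violS y : violated C (splice V y x) = S ->
    splice V (splice V y x) x' = y -> violated C y = S.
  move=> yS yy; have := @violated_splice x x' (splice V y x) Cext xx'.
  by rewrite /violated_vars yS -/V yy; apply=> k /negbTE kV; rewrite ffunE kV.
apply: eq_big => [y|y /andP[/andP[/eqP yS _] /eqP yy]].
  rewrite splice_agree andbT; apply/andP/andP => -[/eqP yS].
    by move=> /eqP yy; rewrite violS// -yy.
  move=> /agreeP yx'; rewrite splice_splice//; split=> //.
  have := @violated_splice x' x y Cext (esym xx').
  by rewrite /violated_vars yS -/V => ->.
have y'S : violated C y = S by exact: violS.
have := IH (splice V y x) y; rewrite yS y'S => /(_ erefl).
rewrite !(coins_probID V).
rewrite (@eq_coins_prob _ (splice V y x) y); last first.
  by move=> k kV; rewrite ffunE kV.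
rewrite (@eq_coins_prob _ (splice V y x) x); last first.
  by move=> k; rewrite ffunE inE => /negbTE ->.
rewrite (@eq_coins_prob (mem (~: V)%SET) y x'); last first.
  by move=> k; rewrite -{1}yy ffunE inE => /negbTE ->.
(* Both sides of [bal] carry the weight of [y] on [V]; multiplying the goal by this positive factor
   lets [bal] apply. *)
move=> bal; apply: (mulIf (lt0r_neq0 (coins_prob_gt0 (mem V) y))).
transitivity (coins_prob (mem V) x * coins_prob (mem V) x' *
  (state_prob t (splice V y x) *
   (coins_prob (mem V) y * coins_prob (mem (~: V)%SET) x'))); first by ring.
by rewrite bal; ring.
Qed.

End BalanceOfStates.

Lemma measure_bigcup_finType (R : realType) (d : measure_display)
    (T : measurableType d) (mu : {measure set T -> \bar R}) (I : finType)
    (F : I -> set T) :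
  trivIset setT F -> (forall i, measurable (F i)) ->
  mu (\bigcup_i F i) = (\sum_i mu (F i))%E.
Proof.
move=> tF mF; rewrite measure_fin_bigcup//; last exact: finite_finset.
rewrite (fsbigE (index_enum I)) ?index_enum_uniq//=.
  by apply: eq_bigl => i; rewrite in_setT.
by move=> i _; rewrite mem_index_enum.
Qed.

(** * The law of the random state is [state_prob] *)

Section LawOfStates.
Variables (R : realType) (n L : nat) (C : 'I_L -> constraint n).
Variables (theta : 'I_n -> R) (d : measure_display) (T : measurableType d).
Variables (P : probability T R) (Z : nat -> 'I_n -> {RV P >-> bool}).
Hypothesis Zcoins : are_coins theta Z.

Let st t w := state C (fun t k => Z t k w) t.

(** Cylinder event on finitely many coins, indexed by a list so that [mutually_independent] applies
    when the list is duplicate-free. *)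
Definition coins_eq (J : seq (nat * 'I_n)) (b : nat * 'I_n -> bool) : set T :=
  [set w | all (fun i => Z i.1 i.2 w == b i) J].

Lemma coins_eqE J b :
  coins_eq J b = \bigcap_(i in [set` J]) Z i.1 i.2 @^-1` [set b i].
Proof.
apply/seteqP; split=> w.
  by move=> /allP h i iJ; apply/eqP; exact: h.
by move=> h; apply/allP => i iJ; apply/eqP; exact: h.
Qed.

Lemma coins_eq_cat J1 J2 b :
  coins_eq (J1 ++ J2) b = coins_eq J1 b `&` coins_eq J2 b.
Proof.
apply/seteqP; rewrite /coins_eq; split=> w /=; rewrite all_cat.
  exact/andP.
by move=> h; apply/andP.
Qed.

Lemma coins_eq_map (V : {set 'I_n}) t b :
  coins_eq [seq (t, k) | k <- enum V] b =
  [set w | forall k, k \in V -> Z t k w = b (t, k)].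
Proof.
apply/seteqP; rewrite /coins_eq; split=> w /=; rewrite all_map => h.
  by move=> k kV; apply/eqP; apply: (allP h); rewrite mem_enum.
by apply/allP => k; rewrite mem_enum => kV /=; apply/eqP/h.
Qed.

Lemma eq_coins_eq J b b' :
  (forall i, i \in J -> b i = b' i) -> coins_eq J b = coins_eq J b'.
Proof.
by move=> bb'; rewrite !coins_eqE; apply: eq_bigcapr => i /bb' ->.
Qed.

Lemma measurable_coins_eq J b : measurable (coins_eq J b).
Proof.
rewrite coins_eqE; apply: fin_bigcap_measurable; first exact: finite_seq.
by move=> i _; apply: measurable_funPTI.
Qed.

Lemma probability_coins_eq J b : uniq J ->
  P (coins_eq J b) = (\prod_(i <- J) marginal (theta i.2) (b i))%:E.
Proof.
move=> uJ; rewrite coins_eqE.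
have [Zmarginal Zindep] := Zcoins.
rewrite (Zindep J (fun i => [set b i]) uJ)//.
by rewrite -prodEFin; apply: eq_bigr => i _; exact: Zmarginal.
Qed.

Lemma state_succ_eq t x y w : st t w = y ->
  st t.+1 w = x <->
  [forall k, (k \notin violated_vars C y) ==> (y k == x k)] /\
  (forall k, k \in violated_vars C y -> Z t.+1 k w = x k).
Proof.
rewrite /st /= => ->; split.
  move=> /ffunP h; split.
    by apply/forallP => k; apply/implyP => /negbTE kV; rewrite -h ffunE kV.
  by move=> k kV; rewrite -h ffunE kV.
move=> [/forallP h1 h2]; apply/ffunP => k; rewrite ffunE.
by case: ifPn => [/h2//|kV]; apply/eqP; exact: (implyP (h1 k)).
Qed.

(** Given state [y], reaching [x] only constrains the coins of round [t.+1] on the redrawn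
    variables. These are not in [J], so both families merge into one cylinder. *)
Lemma redraw_cases t x y J b : (forall i, i \in J -> (t.+1 < i.1)%N) ->
  let V := violated_vars C y in
  ((st t.+1 @^-1` [set x]) `&` coins_eq J b) `&` st t @^-1` [set y] =
  if [forall k, (k \notin V) ==> (y k == x k)] then
    st t @^-1` [set y] `&`
    coins_eq ([seq (t.+1, k) | k <- enum V] ++ J)
      (fun i => if i.1 == t.+1 then x i.2 else b i)
  else set0.
Proof.
move=> Jt V; rewrite coins_eq_cat coins_eq_map /= eqxx.
have -> : coins_eq J (fun i => if i.1 == t.+1 then x i.2 else b i) =
    coins_eq J b.
  apply: eq_coins_eq.
  by move=> i /Jt; rewrite ltnNge; case: eqP => // ->; rewrite leqnn.
case: ifPn => agree; apply/seteqP; split=> w //=.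
- by move=> [[/[swap] bJ /[swap] yw /(state_succ_eq _ yw)[_ ?]]].
- by move=> [yw [? ?]]; do 2 split => //; apply/(state_succ_eq _ yw).
- move=> [[/[swap] bJ /[swap] yw /(state_succ_eq _ yw)[]]].
  by rewrite (negbTE agree).
Qed.

Lemma coins_redraw_uniq t (V : {set 'I_n}) J :
  uniq J -> (forall i, i \in J -> (t < i.1)%N) ->
  uniq ([seq (t, k) | k <- enum V] ++ J).
Proof.
move=> uJ Jt; rewrite cat_uniq uJ andbT map_inj_uniq ?enum_uniq/=; last first.
  by move=> ? ? [].
by apply/hasPn => i /Jt ti; apply/mapP => -[k _ ik]; rewrite ik ltnn in ti.
Qed.

Lemma coins_redraw_prod t (V : {set 'I_n}) J (x : assignment n) b :
  (forall i, i \in J -> (t < i.1)%N) ->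
  \prod_(i <- [seq (t, k) | k <- enum V] ++ J)
    marginal (theta i.2) (if i.1 == t then x i.2 else b i) =
  coins_prob theta (mem V) x * \prod_(i <- J) marginal (theta i.2) (b i).
Proof.
move=> Jt; rewrite big_cat big_map/=; congr (_ * _).
  by rewrite eqxx big_enum.
rewrite big_seq [RHS]big_seq; apply: eq_bigr => i /Jt.
by rewrite ltnNge; case: eqP => // ->; rewrite leqnn.
Qed.

(* The joint statement with coins of later rounds is what makes the induction
   go through: the coins read at round [t.+1] are moved into [J]. *)
Lemma probability_state_coins t x J b : uniq J ->
  (forall i, i \in J -> (t < i.1)%N) ->
  measurable (st t @^-1` [set x] `&` coins_eq J b) /\
  P (st t @^-1` [set x] `&` coins_eq J b) =
  (state_prob C theta t x * \prod_(i <- J) marginal (theta i.2) (b i))%:E.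
Proof.
elim: t x J b => [|t IH] x J b uJ Jt.
  (* The initial draw is treated as a redraw of all the variables. *)
  have -> : st 0 @^-1` [set x] `&` coins_eq J b =
      coins_eq ([seq (0%N, k) | k <- enum [set: 'I_n]%SET] ++ J)
        (fun i => if i.1 == 0%N then x i.2 else b i).
    rewrite coins_eq_cat coins_eq_map /=.
    have -> : coins_eq J (fun i => if i.1 == 0%N then x i.2 else b i) =
        coins_eq J b.
      apply: eq_coins_eq.
      by move=> i /Jt; case: eqP => // ->.
    congr (_ `&` _); apply/seteqP; split=> w /=.
      by move=> <- k _; rewrite ffunE.
    by move=> h; apply/ffunP => k; rewrite ffunE h// inE.
  split; first exact: measurable_coins_eq.
  rewrite probability_coins_eq ?coins_redraw_uniq// coins_redraw_prod//.
  by congr (_ * _)%:E; apply: eq_bigl => k; rewrite !inE.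
set A := _ `&` _.
have AE : A = \bigcup_y (A `&` st t @^-1` [set y]).
  by apply/seteqP; split=> [w Aw|w [y _ []//]]; exists (st t w).
have trivA : trivIset setT (fun y => A `&` st t @^-1` [set y]).
  exact: trivIset_preimage1_in.
(* Measurability is carried along with the probability: both are obtained by splitting on the state
   [y] at round [t]. *)
have mA y : measurable (A `&` st t @^-1` [set y]) /\
    P (A `&` st t @^-1` [set y]) =
    (state_prob C theta t y * redraw_prob C theta y x *
     \prod_(i <- J) marginal (theta i.2) (b i))%:E.
  rewrite redraw_cases//= /redraw_prob; case: ifP => _; last first.
    by rewrite measure0 mulr0 mul0r; split => //; exact: measurable0.
  set V := violated_vars C y.
  have [||? ->] := IH y ([seq (t.+1, k) | k <- enum V] ++ J)
     (fun i => if i.1 == t.+1 then x i.2 else b i).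
  - exact: coins_redraw_uniq.
  - move=> i; rewrite mem_cat => /orP[/mapP[k _ ->]//|/Jt]; exact: ltnW.
  by split=> //; rewrite coins_redraw_prod// mulrA.
rewrite AE; split.
  apply: fin_bigcup_measurable; first exact: finite_finset.
  by move=> y _; have [] := mA y.
rewrite measure_bigcup_finType//; last by move=> y; have [] := mA y.
rewrite /= !mulr_suml -sumEFin; apply: eq_bigr => y _.
by have [] := mA y.
Qed.

Lemma measurable_state t x : measurable (st t @^-1` [set x]).
Proof.
have [] := @probability_state_coins t x [::] (fun=> true) isT => //.
by rewrite coins_eqE set_nil bigcap_set0 setIT.
Qed.

Lemma probability_state t x :
  P (st t @^-1` [set x]) = (state_prob C theta t x)%:E.
Proof.
have [] := @probability_state_coins t x [::] (fun=> true) isT => //.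
by rewrite coins_eqE set_nil bigcap_set0 setIT big_nil mulr1.
Qed.

End LawOfStates.

(** * Outputs for a fixed sequence of coins *)

Section Outputs.
Variables (n L : nat) (C : 'I_L -> constraint n) (z : nat -> 'I_n -> bool).

Lemma state_absorbing s t : satisfies C (state C z s) -> (s <= t)%N ->
  state C z t = state C z s.
Proof.
move=> sat; elim: t => [|t IH]; first by rewrite leqn0 => /eqP <-.
rewrite leq_eqVlt => /predU1P[<-//|/IH st /=].
apply/ffunP => k; rewrite ffunE st ifF//; apply/negbTE.
apply/bigcupP => -[j]; rewrite violatedP => /negP[].
exact: (forallP sat).
Qed.

(** By absorption, a satisfying assignment visited at any round is already the state at the first
    satisfying round. The output event thus becomes a union over rounds, without stopping times. *)
Lemma outputsP x :
  outputs C z x <-> satisfies C x /\ exists t, state C z t = x.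
Proof.
split=> [[t [[sat _] <-]]|[satx [t tx]]]; first by split=> //; exists t.
have ex : exists t, satisfies C (state C z t) by exists t; rewrite tx.
have [s sat_s smin] := ex_minnP ex.
exists s; split.
  by split=> // r rs; apply/negP => /smin; rewrite leqNgt rs.
by rewrite -tx (state_absorbing sat_s)// smin// tx.
Qed.

Lemma outputs_uniq x y : outputs C z x -> outputs C z y -> x = y.
Proof.
move=> /outputsP[satx [s sx]] /outputsP[saty [t ty]].
wlog st : x y s t satx saty sx ty / (s <= t)%N.
  by move=> wl; case/orP: (leq_total s t) => /wl h; [|symmetry]; exact: h.
by rewrite -sx -ty (state_absorbing _ st)// sx.
Qed.

Lemma terminatesP : terminates C z <-> exists x, outputs C z x.
Proof.
split=> [[t st]|[x [t [st _]]]]; last by exists t.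
by exists (state C z t), t.
Qed.

End Outputs.

(** * Passage to the limit and normalization *)

Lemma mrf_weightE (R : realType) (n : nat) (theta : 'I_n -> R)
    (x : assignment n) :
  mrf_weight theta x =
  coins_prob theta predT x * \prod_(k < n) (1 + expR (theta k)).
Proof.
rewrite /mrf_weight expR_sum /coins_prob -big_split/=; apply: eq_bigr => k _.
by rewrite /marginal divfK// gt_eqF// addr_gt0 ?expR_gt0.
Qed.

Theorem theorem1 (R : realType) (n L : nat) (C : 'I_L -> constraint n)
  (theta : 'I_n -> R) (d : measure_display) (T : measurableType d)
  (P : probability T R) (Z : nat -> 'I_n -> {RV P >-> bool})
  (Cextremal : extremal C) (Csat : exists x : assignment n, satisfies C x)
  (Zcoins : are_coins theta Z) (x : assignment n) :
  cond_prob P [set w | outputs C (fun t k => Z t k w) x]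
              [set w | terminates C (fun t k => Z t k w)]
  = constrained_mrf theta C x.
Proof.
pose O y := [set w | outputs C (fun t k => Z t k w) y].
pose St t y := (fun w => state C (fun t k => Z t k w) t) @^-1` [set y].
have mSt t y : measurable (St t y) by apply: (measurable_state _ Zcoins).
have PSt t y : P (St t y) = (state_prob C theta t y)%:E.
  exact: probability_state.
have OE y : satisfies C y -> O y = \bigcup_t St t y.
  move=> saty; apply/seteqP; split=> w.
    by move=> /outputsP[_ [t ty]]; exists t.
  by move=> [t _ ty]; apply/outputsP; split=> //; exists t.
have O0 y : ~~ satisfies C y -> O y = set0.
  by move=> saty; apply/seteqP; split=> w // /outputsP[]; rewrite (negbTE saty).
have mO y : measurable (O y).
  have [/OE ->|/O0 ->] := boolP (satisfies C y); last exact: measurable0.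
  by apply: bigcup_measurable => t _; exact: mSt.
have termE : [set w | terminates C (fun t k => Z t k w)] = \bigcup_y O y.
  apply/seteqP; split=> w; first by move=> /terminatesP[y ?]; exists y.
  by move=> [y _ ?]; apply/terminatesP; exists y.
have trivO : trivIset setT O.
  move=> y y' _ _ [w [yw y'w]].
  exact: (@outputs_uniq _ _ C (fun t k => Z t k w)).
pose p y := fine (P (O y)).
have PO y : P (O y) = (p y)%:E by rewrite fineK// fin_num_measure.
have p_lim y : satisfies C y -> state_prob C theta t y @[t --> \oo] --> p y.
  move=> saty.
  have : P (St t y) @[t --> \oo] --> P (O y).
    (* Continuity from below: the events [St t y] increase with [t] because [y] is absorbing. *)
    rewrite OE//; apply: nondecreasing_cvg_mu => //.
      by apply: bigcup_measurable => t _; exact: mSt.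
    move=> s t st; apply/subsetPset => w sy.
    by rewrite /St /= (state_absorbing _ st) sy.
  under eq_fun do rewrite PSt.
  by rewrite PO => /fine_cvg.
have p_balanced y y' : satisfies C y -> satisfies C y' ->
    p y * coins_prob theta predT y' = p y' * coins_prob theta predT y.
  move=> saty saty'.
  have vv : violated C y = violated C y'.
    by apply/setP => j; rewrite !violatedP (forallP saty) (forallP saty').
  have lim u u' : satisfies C u ->
      state_prob C theta t u * coins_prob theta predT u' @[t --> \oo] -->
      p u * coins_prob theta predT u'.
    by move=> satu; apply: cvgM; [exact: p_lim|exact: cvg_cst].
  (* By balance at each round, both sides are limits of the same sequence. *)
  apply: (cvg_unique (@norm_hausdorff _ _) (lim y y' saty)).
  rewrite (_ : (fun t => _) = (fun t => state_prob C theta t y' *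
      coins_prob theta predT y)); first exact: lim.
  by apply/funext => t; exact: state_prob_balanced.
have p0 y : ~~ satisfies C y -> p y = 0.
  by move=> /O0; rewrite /p => ->; rewrite measure0.
have [x0 satx0] := Csat.
(* The initial draw already equals [x0] with positive probability, so [c] below divides by a nonzero
   number. *)
have px0 : 0 < p x0.
  apply: (@lt_le_trans _ _ (coins_prob theta predT x0)).
    exact: coins_prob_gt0.
  rewrite -lee_fin -PO -[coins_prob _ _ _]/(state_prob C theta 0 x0) -PSt.
  apply: le_measure; rewrite ?inE//.
  by rewrite OE// => w wx0; exists 0%N.
pose c := coins_prob theta predT x0 / p x0.
have c_gt0 : 0 < c by rewrite divr_gt0// coins_prob_gt0.
pose K := \prod_(k < n) (1 + expR (theta k)).
have K_gt0 : 0 < K by apply: prodr_gt0 => k _; rewrite addr_gt0 ?expR_gt0.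
(* Balance against [x0] gives [coins_prob theta predT y = c * p y] for satisfying [y]; otherwise
   both sides vanish. The factor [c * K] does not depend on [y] and cancels in the quotient. *)
have weightE y : mrf_weight theta y * (satisfies C y)%:R = c * K * p y.
  have [saty|/p0->] := boolP (satisfies C y); last by rewrite !mulr0.
  rewrite mrf_weightE -/K mulr1 /c.
  rewrite -[LHS](mulfK (lt0r_neq0 px0)).
  rewrite [_ * K * p x0](_ : _ = K * (p x0 * coins_prob theta predT y)).
    by rewrite (p_balanced x0 y)//; ring.
  by ring.
rewrite /constrained_mrf; under eq_bigr do rewrite weightE.
rewrite weightE -mulr_sumr -mulf_div divff ?mul1r; last first.
  by rewrite gt_eqF// mulr_gt0.
(* Termination is the disjoint union of the output events, so its probability is the sum of [p]. *)
rewrite /cond_prob termE setIidl; last by move=> w xw; exists x.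
rewrite measure_bigcup_finType//; congr (_ / _).
rewrite -[RHS]/(fine (\sum_y p y)%:E) -sumEFin.
by congr fine; apply: eq_bigr => y _; exact: PO.
Qed.
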